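(* Let $Q$ be a probability measure on a filtered measurable space $(\Omega,\mathcal F,(\mathcal F_t)_{t\in\mathbb N_0})$ and let $E=(E_t)_{t\in\mathbb N_0}$ be a nonnegative, finite-valued stochastic process that is nondecreasing in $t$. For $\alpha\in(0,1)$ set $T_\alpha(E):=\inf\{t\in\mathbb N_0:E_t\ge1/\alpha\}$ and let $L\in(0,\infty)$. (i) If $\frac{\log E_t}{t}\to L$ $Q$-almost surely as $t\to\infty$, then $Q$-almost surely as $\alpha\downarrow0$, $$\frac{T_\alpha(E)}{\log(1/\alpha)}\longrightarrow\frac1L.$$ (ii) If $\frac{\log E_t}{t}\to L$ in $Q$-probability as $t\to\infty$, then $\frac{T_\alpha(E)}{\log(1/\alpha)}\to\frac1L$ in $Q$-probability as $\alpha\downarrow0$.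
   Context: $\mathbb N_0=\{0,1,2,\dots\}$; conventions $\inf\emptyset=\infty$ and $\log0=-\infty$. *)

(* Defs.v *)
From HB Require Import structures.
From mathcomp Require Import all_boot all_order all_algebra.
From mathcomp Require Import all_classical all_reals all_analysis.

Set Implicit Arguments.
Unset Strict Implicit.
Unset Printing Implicit Defensive.

Import Order.TTheory GRing.Theory Num.Theory.
Import numFieldNormedType.Exports.

Local Open Scope classical_set_scope.
Local Open Scope ring_scope.

Definition filtration (d : measure_display) (T : measurableType d)
    (F : nat -> set (set T)) : Prop :=
  [/\ forall t, sigma_algebra setT (F t),
      forall t, F t `<=` @measurable d T
    & forall s t : nat, (s <= t)%N -> F s `<=` F t].

(* Extended-real valued: the infimum of the empty set is +oo. *)
Definition first_passage (R : realType) (T : Type) (E : nat -> T -> R)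
    (alpha : R) (w : T) : \bar R :=
  ereal_inf [set (t%:R)%:E | t in [set t : nat | alpha^-1 <= E t w]].

(* [lne], unlike [ln], satisfies log 0 = -oo. The value at t = 0, where the
   division is by zero, does not affect limits as t tends to infinity. *)
Definition log_rate (R : realType) (T : Type) (E : nat -> T -> R)
    (t : nat) (w : T) : \bar R :=
  (lne (E t w)%:E / (t%:R)%:E)%E.

Definition normalized_passage (R : realType) (T : Type) (E : nat -> T -> R)
    (alpha : R) (w : T) : \bar R :=
  (first_passage E alpha w / (ln alpha^-1)%:E)%E.

Definition cvg_as (d : measure_display) (T : measurableType d) (R : realType)
    (Q : probability T R) (I : Type) (F : set_system I) (X : I -> T -> \bar R)
    (l : R) : Prop :=
  {ae Q, forall w, X i w @[i --> F] --> l%:E}.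

(* Infinite values of X i count as being far from l: their distance is +oo. *)
Definition cvg_in_probability (d : measure_display) (T : measurableType d)
    (R : realType) (Q : probability T R) (I : Type) (F : set_system I)
    (X : I -> T -> \bar R) (l : R) : Prop :=
  forall eps : R, 0 < eps ->
    Q [set w | (eps%:E < `|X i w - l%:E|)%E] @[i --> F] --> 0%E.

(* Main.v *)
(** If [T_alpha] is larger than [a * log (1/alpha)] for some [a > 1/L], then at
    the deterministic time [t = floor (a * log (1/alpha))] the process is still
    below [1/alpha], so [log E_t / t] stays below [L] by a margin depending only
    on [a]; symmetrically for [a < 1/L]. Hence, for small [alpha] and uniformly
    on Omega, a deviation of the normalized passage time forces a deviation of
    the logarithmic rate at one of two deterministic times, both tending to
    infinity as [alpha] tends to 0. Both modes of convergence transfer through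
    this inclusion of events. *)
Require Import Defs.
From HB Require Import structures.
From mathcomp Require Import all_boot all_order all_algebra.
From mathcomp Require Import all_classical all_reals all_analysis.
From mathcomp Require Import measurable_realfun lra.

Import Order.TTheory GRing.Theory Num.Theory.
Import numFieldNormedType.Exports.

Local Open Scope classical_set_scope.
Local Open Scope ring_scope.

Lemma cvg_ln_inv_right0 (R : realType) : ln a^-1 @[a --> (0 : R)^'+] --> +oo.
Proof.
apply/cvgryPgt => A; near=> a.
have a0 : 0 < a by near: a; exact: nbhs_right_gt.
rewrite -{1}(expRK A) ltr_ln ?posrE ?expR_gt0 ?invr_gt0// -[expR A]invrK.
rewrite ltf_pV2 ?posrE ?invr_gt0 ?expR_gt0//.
by near: a; apply: nbhs_right_lt; rewrite invr_gt0 expR_gt0.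
Unshelve. all: by end_near. Qed.

Lemma cvg_truncn_pinfty {R : realType} {I : Type} {F : set_system I}
    {FF : Filter F} {f : I -> R} :
  f @ F --> +oo -> Num.truncn (f i) @[i --> F] --> \oo.
Proof.
move=> /cvgryPge fy; apply/cvgnyPge => A.
apply: filterS (fy A%:R) => i Ai.
by rewrite -[A](@natrK R) le_truncn.
Qed.

Lemma lte_abseB {R : realDomainType} (x : \bar R) (l eps : R) :
  (eps%:E < `|x - l%:E|)%E = ((l + eps)%:E < x)%E || (x < (l - eps)%:E)%E.
Proof.
case: x => [r| |] /=; last 2 first.
- by rewrite !ltry.
- by rewrite ltry ltNyr.
by rewrite !lte_fin lter_normr; congr orb; apply/idP/idP; lra.
Qed.

(** An infinite value lies at distance [+oo] from [l], so bounded deviation already forces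
    finiteness. Almost sure convergence can thus be read off the same deviation events as
    convergence in probability. *)
Lemma cvg_EFinP {R : realType} {I : Type} {F : set_system I} {FF : Filter F}
    (f : I -> \bar R) (l : R) :
  f @ F --> l%:E <->
  forall eps : R, 0 < eps -> \forall i \near F, ~ (eps%:E < `|f i - l%:E|)%E.
Proof.
split=> [/fine_cvgP[ffin /cvgrPdist_le fl] eps eps0|fl].
  apply: filterS2 ffin (fl _ eps0) => i fi; rewrite /= distrC.
  by rewrite -{2}(fineK fi) -EFinB lte_fin => ?; apply/negP; rewrite -leNgt.
have ffin : \forall i \near F, f i \is a fin_num.
  apply: filterS (fl 1 ltr01) => i; apply: contra_notT.
  by case: (f i) => //= _; rewrite ltry.
apply/fine_cvgP; split=> //; apply/cvgrPdist_le => eps eps0.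
apply: filterS2 ffin (fl _ eps0) => i fi /negP.
by rewrite -{1}(fineK fi) -EFinB lte_fin -leNgt distrC.
Qed.

Section passage.
Context {R : realType} {T : Type} (E : nat -> T -> R).

Lemma first_passage_gt {alpha : R} {w : T} {t : nat} :
  (t%:R%:E < first_passage E alpha w)%E -> E t w < alpha^-1.
Proof.
rewrite !ltNge; apply: contra => tE.
by apply: ereal_inf_lbound; exists t.
Qed.

Lemma first_passage_lt {alpha : R} {w : T} {x : R} :
  (first_passage E alpha w < x%:E)%E ->
  exists2 t : nat, t%:R < x & alpha^-1 <= E t w.
Proof.
by move=> /ereal_inf_lt[_ [t tE <-]]; rewrite lte_fin => tx; exists t.
Qed.

Lemma log_rate_lt {t : nat} {w : T} {y m : R} : (0 < t)%N -> 0 < y ->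
  E t w < y -> ln y <= m * t%:R -> (log_rate E t w < m%:E)%E.
Proof.
move=> t0 y0 Ey ym.
rewrite /log_rate inver pnatr_eq0 gtn_eqF// lte_pdivrMr ?ltr0n// -EFinM.
(* Where the process vanishes, the rate is [-oo], below any real bound. *)
have [E0|E0] := leP (E t w) 0; first by rewrite le0_lneNy ?lee_fin// ltNyr.
by rewrite lne_EFin// lte_fin (lt_le_trans _ ym)// ltr_ln ?posrE.
Qed.

Lemma log_rate_gt {t : nat} {w : T} {y m : R} : (0 < t)%N -> 0 < y ->
  y <= E t w -> m * t%:R < ln y -> (m%:E < log_rate E t w)%E.
Proof.
move=> t0 y0 yE ym.
rewrite /log_rate inver pnatr_eq0 gtn_eqF// lte_pdivlMr ?ltr0n// -EFinM.
have E0 := lt_le_trans y0 yE.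
by rewrite lne_EFin// lte_fin (lt_le_trans ym)// ler_ln ?posrE.
Qed.

(** Write [l] for [ln alpha^-1] and [u] for the truncation of [a * l]. Passage has not occurred by
    time [u], so the rate there is below [l / u], which tends to [1/a < L]. *)
Lemma normalized_passage_gt {L a : R} : 0 < L -> L^-1 < a ->
  exists2 delta : R, 0 < delta & \forall alpha \near 0^'+, forall w,
    (a%:E < normalized_passage E alpha w)%E ->
    (log_rate E (Num.truncn (a * ln alpha^-1)) w < (L - delta)%:E)%E.
Proof.
move=> L0 aL.
have a0 : 0 < a by rewrite (lt_trans _ aL)// invr_gt0.
have aVL : a^-1 < L by rewrite -[L]invrK ltf_pV2 ?posrE ?invr_gt0.
have aV : a^-1 * a = 1 by rewrite mulVf// gt_eqF.
have aV0 : 0 < a^-1 by rewrite invr_gt0.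
(* The midpoint is below [L], while [m * a > 1] leaves room for rounding [a * l] down. *)
set m := (L + a^-1) / 2.
have ma : 1 < m * a by rewrite /m; nra.
exists (L - m); first by rewrite /m; lra.
have /cvgryPge lyle := cvg_ln_inv_right0 R.
have /cvgryPgt lylt := cvg_ln_inv_right0 R.
near=> alpha => w.
have alpha0 : 0 < alpha by near: alpha; exact: nbhs_right_gt.
have l0 : 0 < ln alpha^-1 by near: alpha; exact: lylt.
(* Gives [a * l >= 1], so that the truncated time is positive. *)
have la : a^-1 <= ln alpha^-1 by near: alpha; exact: lyle.
(* Amounts to [l <= m * (a * l - 1)], hence [l <= m * u] because [u > a * l - 1]. *)
have lm : m / (m * a - 1) <= ln alpha^-1 by near: alpha; exact: lyle.
set l := ln alpha^-1 in l0 la lm *.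
have al0 : 0 <= a * l by rewrite mulr_ge0// ltW.
rewrite /normalized_passage -/l inver (gt_eqF l0) lte_pdivlMr// -EFinM => Tal.
have := truncn_itv al0; set u := Num.truncn _ => /andP[ul lu].
rewrite subKr; apply: (log_rate_lt (y := alpha^-1)); rewrite ?invr_gt0//.
- by rewrite /u truncn_gt0; nra.
- by apply: first_passage_gt; rewrite (le_lt_trans _ Tal)// lee_fin.
- rewrite -/l; move: lm; rewrite ler_pdivrMr ?subr_gt0// => lm.
  move: lu; rewrite -natr1 => lu.
  have m0 : 0 < m by rewrite /m; lra.
  have : m * (a * l) < m * (u%:R + 1) by rewrite ltr_pM2l.
  lra.
Unshelve. all: by end_near. Qed.

(** By monotonicity, a level reached before [a * l] is still exceeded or met at [u + 1 > a * l]. The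
    rate there is at least [l / (u + 1)], which tends to [1/a > L]; rounding up explains the
    successor. *)
Lemma normalized_passage_lt {L a : R} : 0 < a -> a < L^-1 ->
  (forall (w : T) (s t : nat), (s <= t)%N -> E s w <= E t w) ->
  exists2 delta : R, 0 < delta & \forall alpha \near 0^'+, forall w,
    (normalized_passage E alpha w < a%:E)%E ->
    ((L + delta)%:E < log_rate E (Num.truncn (a * ln alpha^-1)).+1 w)%E.
Proof.
move=> a0 aL Emono.
have L0 : 0 < L by rewrite -invr_gt0 (lt_trans a0).
have aVL : L < a^-1 by rewrite -[L]invrK ltf_pV2 ?posrE ?invr_gt0.
have aV : a^-1 * a = 1 by rewrite mulVf// gt_eqF.
set m := (L + a^-1) / 2.
have ma : m * a < 1 by rewrite /m; nra.
exists (m - L); first by rewrite /m; lra.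
have /cvgryPgt lylt := cvg_ln_inv_right0 R.
near=> alpha => w.
have alpha0 : 0 < alpha by near: alpha; exact: nbhs_right_gt.
have l0 : 0 < ln alpha^-1 by near: alpha; exact: lylt.
(* Amounts to [m * (a * l + 1) < l], which absorbs the rounding since [u <= a * l]. *)
have lm : m / (1 - m * a) < ln alpha^-1 by near: alpha; exact: lylt.
set l := ln alpha^-1 in l0 lm *.
have al0 : 0 <= a * l by rewrite mulr_ge0// ltW.
rewrite /normalized_passage -/l inver (gt_eqF l0) lte_pdivrMr// -EFinM.
move=> /first_passage_lt[t tal tE].
have := truncn_itv al0; set u := Num.truncn _ => /andP[ul lu].
rewrite addrC subrK; apply: (log_rate_gt (y := alpha^-1)); rewrite ?invr_gt0//.
- apply: (le_trans tE); apply: Emono.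
  by rewrite -(ler_nat R) ltW// (lt_trans tal).
- rewrite -/l; move: lm; rewrite ltr_pdivrMr ?subr_gt0// => lm.
  rewrite -natr1.
  have m0 : 0 < m by rewrite /m; lra.
  have : m * u%:R <= m * (a * l) by rewrite ler_pM2l.
  lra.
Unshelve. all: by end_near. Qed.

(** Neither [delta] nor the times [u] and [v] depend on [w], so the inclusion can be used pathwise
    as well as under [Q]. *)
Lemma normalized_passage_deviation {L eps : R} : 0 < L -> 0 < eps ->
  (forall (w : T) (s t : nat), (s <= t)%N -> E s w <= E t w) ->
  exists (delta : R) (u v : R -> nat),
    [/\ 0 < delta, u alpha @[alpha --> 0^'+] --> \oo,
        v alpha @[alpha --> 0^'+] --> \oo &
        \forall alpha \near 0^'+, forall w,
          (eps%:E < `|normalized_passage E alpha w - L^-1%:E|)%E ->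
          (delta%:E < `|log_rate E (u alpha) w - L%:E|)%E \/
          (delta%:E < `|log_rate E (v alpha) w - L%:E|)%E].
Proof.
move=> L0 eps0 Emono.
have LV0 : 0 < L^-1 by rewrite invr_gt0.
(* The maximum keeps [b] positive when [eps >= 1/L], so that the second time
   still tends to infinity. *)
pose a := L^-1 + eps; pose b := Num.max (L^-1 - eps) (L^-1 / 2).
have b0 : 0 < b by rewrite lt_max divr_gt0// orbT.
have bL : b < L^-1 by rewrite gt_max; apply/andP; split; lra.
have aL : L^-1 < a by rewrite ltrDl.
have [d1 d10 near1] := normalized_passage_gt L0 aL.
have [d2 d20 near2] := normalized_passage_lt b0 bL Emono.
have ly (c : R) : 0 < c -> c * ln x^-1 @[x --> (0 : R)^'+] --> +oo.
  by move=> c0; exact: gt0_cvgMry c0 (cvg_ln_inv_right0 R).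
exists (Num.min d1 d2), (fun x => Num.truncn (a * ln x^-1)),
  (fun x => (Num.truncn (b * ln x^-1)).+1); split.
- by rewrite lt_min d10.
- by apply/cvg_truncn_pinfty/ly; rewrite (lt_trans LV0).
- have vy := (cvgnyPge _).1 (cvg_truncn_pinfty (ly _ b0)).
  apply/cvgnyPge => A; near=> x; apply: leqW; near: x; exact: vy.
- apply: filterS2 near1 near2 => alpha gtP ltP w.
  (* An upper deviation exceeds [a]; a lower one falls below [b], since [b >= 1/L - eps]. *)
  rewrite !lte_abseB => /orP[/gtP|]ratew; [left|right]; apply/orP; [right|left].
    by rewrite (lt_le_trans ratew)// lee_fin lerD2l lerN2 ge_min lexx.
  have /ltP : (normalized_passage E alpha w < b%:E)%E.
    by rewrite (lt_le_trans ratew)// lee_fin le_max lexx.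
  by apply: le_lt_trans; rewrite lee_fin lerD2l ge_min lexx orbT.
Unshelve. all: by end_near. Qed.

End passage.

Section measurability.
Context {d : measure_display} {T : measurableType d} {R : realType}.

Lemma measurable_log_rate (E : nat -> T -> R) (t : nat) :
  measurable_fun setT (E t) -> measurable_fun setT (log_rate E t).
Proof.
move=> mE; rewrite /log_rate; under eq_fun do rewrite muleC.
apply: measurable_funeM.
by apply: measurable_fun_ifT; [exact: measurable_fun_ler| |
  apply/measurable_EFinP/measurableT_comp].
Qed.

Lemma measurable_first_passage (E : nat -> T -> R) (alpha : R) :
  (forall t, measurable_fun setT (E t)) ->
  measurable_fun setT (first_passage E alpha).
Proof.
move=> mE.
(* Times before passage are sent to [+oo], which turns the passage time into a countable infimum of
   measurable functions. *)
pose g t w : \bar R := if alpha^-1 <= E t w then t%:R%:E else +oo%E.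
rewrite (_ : first_passage E alpha = fun w => einfs (g ^~ w) 0).
  apply: measurable_fun_einfs => t; apply: measurable_fun_ifT => //.
  exact: measurable_fun_ler.
apply/funext => w; apply/eqP; rewrite eq_le; apply/andP; split.
  apply: le_ereal_inf_tmp => _ [t _ <-]; rewrite /g.
  by case: ifPn => [tE|_]; [apply: ereal_inf_lbound; exists t|rewrite leey].
apply: le_ereal_inf => _ [t tE <-]; exists t => //.
by rewrite /g tE.
Qed.

Lemma measurable_normalized_passage (E : nat -> T -> R) (alpha : R) :
  (forall t, measurable_fun setT (E t)) ->
  measurable_fun setT (normalized_passage E alpha).
Proof.
move=> mE; rewrite /normalized_passage; under eq_fun do rewrite muleC.
exact/measurable_funeM/measurable_first_passage.
Qed.

Lemma measurable_deviation (f : T -> \bar R) (l eps : R) :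
  measurable_fun setT f -> measurable [set w | (eps%:E < `|f w - l%:E|)%E].
Proof.
move=> mf; rewrite -[X in measurable X]setTI.
apply: measurable_lte => //; apply: measurableT_comp => //.
exact: emeasurable_funB.
Qed.

End measurability.

Theorem proposition5p3 (R : realType) (d : measure_display)
    (Omega : measurableType d) (F : nat -> set (set Omega))
    (hF : filtration F) (Q : probability Omega R)
    (E : nat -> {RV Q >-> R})
    (E_ge0 : forall (t : nat) (w : Omega), 0 <= E t w)
    (E_nondecreasing : forall (w : Omega) (s t : nat),
        (s <= t)%N -> E s w <= E t w)
    (L : R) (L_gt0 : 0 < L) :
  (cvg_as Q \oo (log_rate E) L ->
     cvg_as Q 0^'+ (normalized_passage E) L^-1)
  /\
  (cvg_in_probability Q \oo (log_rate E) L ->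
     cvg_in_probability Q 0^'+ (normalized_passage E) L^-1).
Proof.
have mE t : measurable_fun setT (E t) by [].
split=> [|rate_cvg eps eps0].
  (* The inclusion holds at every [w], so the null set excluded for the rate also serves for the
     passage time. *)
  apply: filterS => w /cvg_EFinP rate_cvg; apply/cvg_EFinP => eps eps0.
  have [delta [u [v [delta0 uy vy dev]]]] :=
    normalized_passage_deviation E L_gt0 eps0 E_nondecreasing.
  have rate_near := rate_cvg _ delta0.
  apply: filterS3 dev (uy _ rate_near) (vy _ rate_near) => alpha dev nu nv.
  by move=> /dev[].
have [delta [u [v [delta0 uy vy dev]]]] :=
  normalized_passage_deviation E L_gt0 eps0 E_nondecreasing.
pose A t := [set w | (delta%:E < `|log_rate E t w - L%:E|)%E].
have mA t : measurable (A t) by apply/measurable_deviation/measurable_log_rate.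
have QA := rate_cvg _ delta0.
(* Union bound: both probabilities vanish because [u] and [v] are deterministic and tend to
   infinity. *)
apply: (@squeeze_cvge _ _ _ _ (cst 0%E) _
  (fun alpha => Q (A (u alpha)) + Q (A (v alpha)))%E).
- apply: filterS dev => alpha dev; rewrite measure_ge0/=.
  apply: (le_trans _ (measureU2 Q (mA _) (mA _))).
  apply: le_measure; rewrite ?inE; last by move=> w /dev.
    exact/measurable_deviation/measurable_normalized_passage.
  exact: measurableU.
- exact: cvg_cst.
- rewrite -[X in _ --> X]adde0; apply: cvgeD => //.
    exact: (cvg_comp _ _ uy QA).
  exact: (cvg_comp _ _ vy QA).
Qed.
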